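(* Let $\psi\in L^\infty(\mathbb{Z})$ vanish on the negative integers and write $a_n=\psi(n)$ for $n\ge0$. Let $\hat\psi$ be the function on the unit disc $\mathbb{D}=\{z\in\mathbb{C}:|z|<1\}$ defined by $$\hat\psi(z)=\sum_{n=0}^\infty a_nz^n .$$ If $\hat\psi$ has $H^1$ boundary behavior at $z=1$, then $\psi$ is almost convergent to $0$.
   Context: A function $f$ on $\mathbb{D}$ has $H^1$ boundary behavior at $z_0=e^{it_0}$ if there exist $\delta>0$ and a function $F(e^{it})$ in $L^1(t_0-\delta,t_0+\delta)$ such that $f(re^{it})$ converges to $F(e^{it})$ in $L^1(t_0-\delta,t_0+\delta)$ as $r\to1^-$. $L^\infty(\mathbb{Z})$ is the space of bounded complex-valued functions on $\mathbb{Z}$, and $(f*\psi)(n)=\sum_{k\in\mathbb{Z}}f(k)\psi(n-k)$. A mean on $L^\infty(\mathbb{Z})$ is $\varphi\in L^\infty(\mathbb{Z})^*$ with $\varphi(\psi)\ge0$ for all $\psi\ge0$ and $\varphi(\mathbf1)=1$; it is topologically invariant if $\varphi(f*\psi)=\varphi(\psi)$ for all $\psi\in L^\infty(\mathbb{Z})$ and all nonnegative $f\in L^1(\mathbb{Z})$ with $\sum_k f(k)=1$. The function $\psi\in L^\infty(\mathbb{Z})$ is almost convergent to $\alpha\in\mathbb{C}$ if $\varphi(\psi)=\alpha$ for every topologically invariant mean $\varphi$ on $L^\infty(\mathbb{Z})$. *)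

(* Defs.v *)
From HB Require Import structures.
From mathcomp Require Import all_boot all_order all_algebra.
From mathcomp Require Import complex.
From mathcomp Require Import all_classical all_reals all_analysis.

Set Implicit Arguments.
Unset Strict Implicit.
Unset Printing Implicit Defensive.
Import Order.TTheory GRing.Theory Num.Theory.
Import numFieldNormedType.Exports.
Import Normc.
Local Open Scope classical_set_scope.
Local Open Scope ring_scope.
Local Open Scope complex_scope.

(* The complex numbers are [R[i]], with real-valued modulus [normc].  Their
   topology lives on the regular module [R[i]^o], hence the casts below. *)

Lemma normc_ge0 (R : realType) (x : R[i]) : 0 <= normc x.
Proof. by case: x => a b; exact: sqrtr_ge0. Qed.

Lemma normr_normc (R : realType) (x : R[i]) : `|x| = (normc x)%:C.
Proof. by []. Qed.

Section Linfty.
Variable R : realType.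

Definition linfty_pred : {pred (int -> R[i])} :=
  [pred psi : int -> R[i] | `[< bounded_fun (psi : int -> R[i]^o) >]].

Lemma linfty_predP (psi : int -> R[i]) :
  reflect (exists M : R, forall n, normc (psi n) <= M) (psi \in linfty_pred).
Proof.
have PF : ProperFilter (globally [set: int]) by exact: (globally_properfilter (a := 0)).
apply: (iffP (asboolP _)).
- move=> /ex_bound[M hM]; exists (complex.Re M) => n.
  have := hM n I; rewrite /= [X in X <= _]normr_normc.
  by case: (M) => a b; rewrite lecE => /andP[].
- move=> [M hM]; apply/ex_bound; exists M%:C => n _ /=.
  by rewrite [X in X <= _]normr_normc lecR.
Qed.

Lemma linfty_submod_closed : submod_closed linfty_pred.
Proof.
split; first by apply/linfty_predP; exists 0 => n; rewrite normc0.
move=> a f g /linfty_predP[M hM] /linfty_predP[N hN].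
apply/linfty_predP; exists (normc a * M + N) => n.
apply: (le_trans (le_normcD _ _)); apply: lerD => //.
rewrite [X in normc X](_ : _ = a * f n)//.
by rewrite normcM ler_wpM2l ?normc_ge0 ?hM.
Qed.

HB.instance Definition _ :=
  GRing.isSubmodClosed.Build _ _ linfty_pred linfty_submod_closed.

Record linfty := Linfty {
  linfty_fun :> int -> R[i];
  _ : linfty_fun \in linfty_pred }.

HB.instance Definition _ := [isSub for linfty_fun].
HB.instance Definition _ := [Choice of linfty by <:].
HB.instance Definition _ := [SubChoice_isSubLmodule of linfty by <:].

Definition linfty_norm (psi : linfty) : R :=
  sup (range (fun n => normc (psi n))).

Lemma linfty1_subproof : (fun _ : int => 1 : R[i]) \in linfty_pred.
Proof. by apply/linfty_predP; exists 1 => n; rewrite normc1. Qed.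

Definition linfty1 : linfty := Linfty linfty1_subproof.

End Linfty.

Section Convolution.
Variable R : realType.

Definition l1 (f : int -> R[i]) : Prop :=
  (\esum_(k in [set: int]) (normc (f k))%:E < +oo)%E.

(* [Negz n] is the integer [- n.+1]. *)
Definition zsum (u : int -> R[i]) : R[i] :=
  limn (series (fun n => u (Posz n)) : nat -> R[i]^o) +
  limn (series (fun n => u (Negz n)) : nat -> R[i]^o).

Definition conv (f psi : int -> R[i]) (n : int) : R[i] :=
  zsum (fun k => f k * psi (n - k)).

Lemma normc_lim_le (u : nat -> R[i]^o) (B : R) : 0 <= B ->
  (forall n, normc (u n) <= B) -> normc (limn u) <= B.
Proof.
move=> B0 uB; have [cu|/dvgP ->] := pselect (cvgn u); last first.
  by rewrite [point]/(0 : R[i]) normc0.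
rewrite leNgt; apply/negP => Blt.
have e0 : 0 < (normc (limn u) - B)%:C :> R[i] by rewrite ltcR subr_gt0.
move/cvgrPdist_lt: cu => /(_ _ e0)[N _ /(_ N (leqnn N))] /=.
rewrite [X in X < _]normr_normc ltcR ltNge => /negP; apply.
rewrite lerBlDr -[X in normc X <= _](subrK (u N)).
by rewrite (le_trans (le_normcD _ _))// lerD2l.
Qed.

Lemma l1_partial (f : int -> R[i]) (h : nat -> int) (N : nat) :
  injective h -> l1 f ->
  \sum_(0 <= k < N) normc (f (h k)) <=
  fine (\esum_(k in [set: int]) (normc (f k))%:E).
Proof.
move=> hi fl1.
have e0 : (0 <= \esum_(k in [set: int]) (normc (f k))%:E)%E.
  by apply: esum_ge0 => k _; rewrite lee_fin normc_ge0.
rewrite -lee_fin fineK ?ge0_fin_numE// -sumEFin.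
have us : uniq [seq h k | k <- index_iota 0 N].
  by rewrite map_inj_uniq// iota_uniq.
apply: esum_ge; exists [set` [seq h k | k <- index_iota 0 N]].
  by split => //; exact: finite_seq.
by rewrite -fsbig_seq// big_map.
Qed.

Lemma conv_linfty (f : int -> R[i]) (psi : linfty R) :
  l1 f -> conv f psi \in @linfty_pred R.
Proof.
move=> fl1; have /linfty_predP[M hM] := valP psi.
have M0 : 0 <= M by apply: le_trans (hM 0); exact: normc_ge0.
set S := fine (\esum_(k in [set: int]) (normc (f k))%:E).
have half (h : nat -> int) n : injective h ->
  normc (limn (series (fun k => f (h k) * psi (n - h k)) : nat -> R[i]^o))
    <= S * M.
  move=> hi; apply: normc_lim_le.
    rewrite mulr_ge0// fine_ge0//; apply: esum_ge0 => k _.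
    by rewrite lee_fin normc_ge0.
  move=> N; apply: (@le_trans _ _ (\sum_(0 <= k < N) normc (f (h k)) * M)).
    rewrite /series /=.
    apply: (big_ind2 (fun (x : R[i]) (y : R) => normc x <= y)).
    - by rewrite normc0.
    - by move=> ? ? ? ? ? ?; rewrite (le_trans (le_normcD _ _))// lerD.
    - by move=> k _; rewrite normcM ler_wpM2l ?normc_ge0 ?hM.
  by rewrite -mulr_suml ler_wpM2r// l1_partial.
apply/linfty_predP; exists (S * M + S * M) => n.
by apply: (le_trans (le_normcD _ _)); apply: lerD; apply: half => ? ? [].
Qed.

Definition linfty_conv (f : int -> R[i]) (fl1 : l1 f) (psi : linfty R) :
  linfty R := Linfty (conv_linfty psi fl1).

End Convolution.

Section Means.
Variable R : realType.
Implicit Types (phi : {linear linfty R -> R[i]^o}) (psi : linfty R).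

Definition bounded_functional phi : Prop :=
  exists M : R, forall psi, normc (phi psi) <= M * linfty_norm psi.

(* In [R[i]], [0 <= z] means that [z] is real and nonnegative. *)
Definition is_mean phi : Prop :=
  [/\ bounded_functional phi,
      forall psi, (forall n, 0 <= psi n) -> 0 <= (phi psi : R[i])
    & phi (linfty1 R) = 1].

Definition topologically_invariant phi : Prop :=
  forall (f : int -> R[i]) (fl1 : l1 f) psi,
    (forall k, 0 <= f k) -> zsum f = 1 ->
    phi (linfty_conv fl1 psi) = phi psi.

Definition almost_convergent psi (alpha : R[i]) : Prop :=
  forall phi, is_mean phi -> topologically_invariant phi -> phi psi = alpha.

End Means.

Section BoundaryBehavior.
Variable R : realType.

Definition expi (t : R) : R[i] := cos t +i* sin t.

Definition complex_L1 (A : set R) (g : R -> R[i]) : Prop :=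
  (@lebesgue_measure R).-integrable A (fun t => (complex.Re (g t))%:E) /\
  (@lebesgue_measure R).-integrable A (fun t => (complex.Im (g t))%:E).

(* Only the values of [f] on the open unit disc matter. *)
Definition H1_boundary_behavior (f : R[i] -> R[i]) (z0 : R[i]) : Prop :=
  exists (t0 delta : R) (F : R[i] -> R[i]),
    let I := `]t0 - delta, t0 + delta[%classic in
    [/\ z0 = expi t0, 0 < delta, complex_L1 I (fun t => F (expi t)),
        \forall r \near 1^'-, complex_L1 I (fun t => f (r%:C * expi t))
      & (\int[@lebesgue_measure R]_(t in I)
           (normc (f (r%:C * expi t) - F (expi t)))%:E)%E
          @[r --> (1 : R)^'-] --> 0%E].

Definition psihat (psi : int -> R[i]) (z : R[i]) : R[i] :=
  limn (series (fun n => psi (Posz n) * z ^+ n) : nat -> R[i]^o).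

End BoundaryBehavior.

(* Main.v *)
Require Import Defs.
From HB Require Import structures.
From mathcomp Require Import all_boot all_order all_algebra.
From mathcomp Require Import complex.
From mathcomp Require Import all_classical all_reals all_analysis.
From mathcomp Require Import measurable_realfun ring lra zify.

(** A topologically invariant mean [phi] is bounded and satisfies
    [phi (f * psi) = phi psi] for every probability [f] on the integers, so it
    suffices to find such [f] with [f * psi] uniformly small
    ([exists_averaging_kernel]).

    Formally [(f * psi) n] is the integral of [psihat (exp(i t))] against the
    Fourier transform of [f] times [exp(- i n t)], divided by [2 pi].  If that
    transform is a triangle supported on a short interval [-d, d], only the
    boundary function [F] near [1] is involved and
    [|(f * psi) n|] is at most a constant times the integral of [|F|] over
    [-d, d], which tends to [0] with [d] because [F] is integrable
    ([integral_itv_small]).  The coefficients of the triangle are proportional to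
    [(1 - cos (k d)) / k ^ 2], hence nonnegative and summable.

    No Fourier inversion is used.  The same weights are the multipliers of
    Riemann's second symmetric difference: applied to the twice integrated
    trigonometric polynomial with coefficients [psi (n - k) r ^ (n - k)], the
    second difference produces the weighted sum
    ([trigterm_second_difference]), and it is bounded by [d] times the integral
    of the polynomial itself over [-d, d] ([second_difference_le]).  Partial sums
    of the power series are compared with [psihat] at a radius [r < 1]
    ([radial_window_le]), and then [r] tends to [1] ([window_Re_le]).  The
    weights are cut to finitely many [k], at a cost that is uniform in [n]
    ([riemann_weight_tail_le]), and normalised; their total mass is at least
    [d] times [cos 1 ^+ 2] ([window_riemann_weight_ge]), so the factor [d] in
    the bound cancels. *)

Set Implicit Arguments.
Unset Strict Implicit.
Unset Printing Implicit Defensive.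
Import Order.TTheory GRing.Theory Num.Theory.
Import numFieldNormedType.Exports.
Import Normc.
Local Open Scope classical_set_scope.
Local Open Scope ring_scope.

(** * Second symmetric differences *)

Section SecondDifference.
Variable R : realType.
Local Notation mu := (@lebesgue_measure R).

Lemma is_derive_continuous (f df : R -> R) :
  (forall u : R, is_derive u 1 f (df u)) -> continuous f.
Proof.
move=> fdf u; apply: differentiable_continuous.
by apply/derivable1_diffP; case: (fdf u).
Qed.

Lemma is_derive_comp_subr (f df : R -> R) (a : R) :
  (forall u : R, is_derive u 1 f (df u)) ->
  forall u : R, is_derive u 1 (fun v => f (v - a)) (df (u - a)).
Proof.
move=> fdf u; rewrite -[df _]mulr1.
have dB : is_derive u 1 (fun v : R => v - a) (1 : R).
  by rewrite -[X in is_derive _ _ _ X]subr0; apply: is_deriveB.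
exact: (is_derive1_comp (f := f) (g := fun v => v - a)).
Qed.

Lemma is_derive_comp_mull (f df : R -> R) (a : R) :
  (forall u : R, is_derive u 1 f (df u)) ->
  forall u : R, is_derive u 1 (fun v => f (a * v)) (df (a * u) * a).
Proof.
move=> fdf u.
have dM : is_derive u 1 (fun v : R => a * v) a.
  by rewrite -[X in is_derive _ _ _ X]mulr1; apply: is_deriveZ.
exact: (is_derive1_comp (f := f) (g := fun v => a * v)).
Qed.

(** The fundamental theorem of calculus as an inequality: the derivative is
    only compared with a measurable majorant [h], which later contains the
    boundary function and so need not be continuous. *)
Lemma increment_le_integral (f df h : R -> R) (a b : R) : a <= b ->
  (forall u : R, is_derive u 1 f (df u)) -> continuous df ->
  measurable_fun `[a, b] h -> (forall u, a <= u <= b -> `|df u| <= h u) ->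
  (`|f b - f a|%R%:E <= \int[mu]_(u in `[a, b]) (h u)%:E)%E.
Proof.
rewrite le_eqVlt => /predU1P[->|ab] fdf cdf mh dfh.
  by rewrite subrr normr0 set_itv1 integral_set1.
have mdf : measurable_fun `[a, b] df.
  by apply: measurable_funTS; exact: continuous_measurable_fun.
have cf := is_derive_continuous fdf.
rewrite [leLHS](_ : _ = `|(f b)%:E - (f a)%:E|%E) //.
have <- : (\int[mu]_(u in `[a, b]) (df u)%:E = (f b)%:E - (f a)%:E)%E.
  apply: continuous_FTC2 => //.
  - exact: continuous_subspaceT.
  - split; first by move=> u _; case: (fdf u).
    + by apply: cvg_at_right_filter; exact: cf.
    + by apply: cvg_at_left_filter; exact: cf.
  - by move=> u _; rewrite derive1E; apply: derive_val.
apply: (le_trans (le_abse_integral mu _ _)) => //; first exact/measurable_EFinP.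
apply: ge0_le_integral => //.
- by apply/measurableT_comp => //; exact/measurable_EFinP.
- exact/measurable_EFinP.
Qed.

(** Riemann's device for localising a trigonometric series.  The second
    symmetric difference equals the integral of [q2''] against the triangle
    [d - |u - x|] on [x - d, x + d].  The bound needs no integration by parts:
    the difference is [D (x + d) - D x] with [D u = q2 u - q2 (u - d)], so by
    the mean value theorem it is [d] times an increment of [q1] over an interval
    of length [d] inside [x - d, x + d]. *)
Lemma second_difference_le (q2 q1 q h : R -> R) (x d : R) : 0 < d ->
  (forall u : R, is_derive u 1 q2 (q1 u)) ->
  (forall u : R, is_derive u 1 q1 (q u)) -> continuous q ->
  measurable_fun `[x - d, x + d] h ->
  (forall u, x - d <= u <= x + d -> `|q u| <= h u) ->
  ((`|q2 (x + d) + q2 (x - d) - q2 x *+ 2|%R)%:E <=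
   d%:E * \int[mu]_(u in `[(x - d)%R, (x + d)%R]) (h u)%:E)%E.
Proof.
move=> d0 dq2 dq1 cq mh qh.
pose D u := q2 u - q2 (u - d).
have dD (u : R) : is_derive u 1 D (q1 u - q1 (u - d)).
  have dsh := is_derive_comp_subr d dq2 u.
  exact: is_deriveB.
have xd : x < x + d by rewrite ltrDl.
have cD : {within `[x, x + d], continuous D}.
  exact/continuous_subspaceT/(is_derive_continuous dD).
have [c] := MVT xd (fun u _ => dD u) cD.
rewrite in_itv /= => /andP[xc cxd] DE.
have -> : q2 (x + d) + q2 (x - d) - q2 x *+ 2 = d * (q1 c - q1 (c - d)).
  by move: DE; rewrite /D addrK; lra.
rewrite normrM gtr0_norm // EFinM lee_pmul2l //.
have sub : `[c - d, c] `<=` `[x - d, x + d].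
  by move=> u; rewrite /= !in_itv /=; lra.
apply: (@le_trans _ _ (\int[mu]_(u in `[(c - d)%R, c]) (h u)%:E)%E).
  apply: (increment_le_integral (df := q)) => //; first by lra.
    by apply: measurable_funS mh.
  by move=> u uc; apply: qh; lra.
apply: ge0_subset_integral => //; first exact/measurable_EFinP.
by move=> u; rewrite /= in_itv /= lee_fin => /qh; apply: le_trans.
Qed.

End SecondDifference.

(** * The Riemann kernel *)

Section Trigonometry.
Variable R : realType.
Implicit Types (a b c d s t : R) (k : int).

(** With [z = b + i c] this is the real part of [z exp(- i k s)]. *)
Definition trigterm k b c s : R := b * cos (k%:~R * s) + c * sin (k%:~R * s).

(** Formal antiderivatives of [trigterm]; the frequency [0] integrates to
    powers of [s], as in Riemann's twice integrated series. *)
Definition trigterm_prim k b c s : R :=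
  if k == 0 then b * s else (b * sin (k%:~R * s) - c * cos (k%:~R * s)) / k%:~R.

Definition trigterm_prim2 k b c s : R :=
  if k == 0 then b * (s ^+ 2 / 2) else - trigterm k b c s / k%:~R ^+ 2.

Lemma is_derive_trigterm_prim k b c (u : R) :
  is_derive u 1 (trigterm_prim k b c) (trigterm k b c u).
Proof.
rewrite /trigterm_prim /trigterm; have [->|k0] := eqVneq k 0.
  rewrite mul0r cos0 sin0 mulr0 addr0.
  by apply: is_deriveZ.
have K0 : k%:~R != 0 :> R by rewrite intr_eq0.
have dc := is_derive_comp_mull k%:~R (@is_derive_cos R) u.
have ds := is_derive_comp_mull k%:~R (@is_derive_sin R) u.
rewrite [X in is_derive _ _ X](_ : _ = (k%:~R)^-1 *:
  ((b *: fun v => sin (k%:~R * v)) - (c *: fun v => cos (k%:~R * v)))).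
  by apply: is_derive_eq; rewrite /GRing.scale /=; field.
by apply/funext => v; rewrite !fctE /GRing.scale /= mulrC.
Qed.

(** For [k <> 0] the second antiderivative is, up to the factor [1 / k], again
    a first antiderivative, with the coefficients rotated by a quarter turn. *)
Lemma is_derive_trigterm_prim2 k b c (u : R) :
  is_derive u 1 (trigterm_prim2 k b c) (trigterm_prim k b c u).
Proof.
rewrite /trigterm_prim2 /trigterm_prim /trigterm; have [_|k0] := eqVneq k 0.
  rewrite [X in is_derive _ _ X](_ : _ = (b / 2) *: (fun v : R => v ^+ 2)).
    by apply: is_derive_eq; rewrite /GRing.scale /=; field.
  by apply/funext => v; rewrite !fctE /GRing.scale /=; ring.
have K0 : k%:~R != 0 :> R by rewrite intr_eq0.
rewrite [X in is_derive _ _ X](_ : _ = k%:~R^-1 *: trigterm_prim k (- c) b).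
  rewrite [X in is_derive _ _ _ X](_ : _ = k%:~R^-1 *: trigterm k (- c) b u).
    exact/is_deriveZ/is_derive_trigterm_prim.
  by rewrite /trigterm /GRing.scale /= mulrC mulNr addrC.
apply/funext => v; rewrite !fctE /GRing.scale /= /trigterm_prim (negbTE k0).
by move: (cos _) (sin _) => C S; move: k%:~R K0 => K K0; field.
Qed.

(** The second difference multiplier.  Up to the factor [2 pi d] this is the
    [k]-th Fourier coefficient of the triangle of height [1] supported on
    [-d, d], hence a nonnegative summable kernel whose Fourier transform lives
    near [0]. *)
Definition riemann_weight d k : R :=
  if k == 0 then d ^+ 2 else (1 - cos (k%:~R * d)) *+ 2 / k%:~R ^+ 2.

Lemma trigterm_second_difference k b c d :
  trigterm_prim2 k b c d + trigterm_prim2 k b c (- d) -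
    trigterm_prim2 k b c 0 *+ 2 = riemann_weight d k * b.
Proof.
rewrite /trigterm_prim2 /riemann_weight /trigterm; case: ifPn => [_|k0].
  by field.
have K0 : k%:~R != 0 :> R by rewrite intr_eq0.
by rewrite mulrN cosN sinN mulr0 cos0 sin0; field.
Qed.

Lemma riemann_weight_ge0 d k : 0 <= riemann_weight d k.
Proof.
rewrite /riemann_weight; case: ifP => _; first exact: sqr_ge0.
by rewrite divr_ge0 ?sqr_ge0 // mulrn_wge0 // subr_ge0 cos_le1.
Qed.

Lemma riemann_weight_le d k : k != 0 -> riemann_weight d k <= 4 / k%:~R ^+ 2.
Proof.
move=> k0; rewrite /riemann_weight (negbTE k0) ler_wpM2r ?invr_ge0 ?sqr_ge0 //.
by have := cos_geN1 (k%:~R * d); lra.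
Qed.

(** A concavity bound good enough to keep the mass of the kernel away from [0];
    the mean value theorem yields the constant [cos 1 > 0]. *)
Lemma sin_ge_cos1 t : 0 <= t <= 1 -> t * cos 1 <= sin t.
Proof.
move=> /andP[t0 t1].
have [] := @MVT_segment R sin cos 0 t t0 (fun x _ => is_derive_sin x).
  by apply/continuous_subspaceT/continuous_sin.
move=> s; rewrite in_itv /= => /andP[s0 st]; rewrite sin0 !subr0 => ->.
rewrite mulrC ler_wpM2r //.
have [->//|s1] := eqVneq s 1.
have p2 := @pi_ge2 R.
apply: ltW; rewrite ltr_cos ?in_itv /=; lra.
Qed.

Lemma riemann_weight_ge d k : 0 <= d -> 0 <= k -> k%:~R * d <= 1 ->
  cos 1 ^+ 2 * d ^+ 2 <= riemann_weight d k.
Proof.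
move=> d0 k0 kd; rewrite /riemann_weight; case: ifPn => [_|kn0].
  rewrite ler_piMl ?sqr_ge0 // expr_le1 ?cos_le1 //.

have K0 : 0 < k%:~R :> R by rewrite ltr0z lt0r kn0.
(* half-angle: [2 - 2 cos (k d) = 4 sin^2 (k d / 2)] *)
set y := k%:~R * d / 2.
have -> : k%:~R * d = y *+ 2 by rewrite /y; field.
rewrite cos_mulr2n (cos2sin2 y).
have y0 : 0 <= y by rewrite /y divr_ge0 // mulr_ge0 // ltW.
have ys : y * cos 1 <= sin y by apply: sin_ge_cos1; rewrite y0 /y /=; lra.
have c1 := @cos1_gt0 R.
have : (y * cos 1) ^+ 2 <= sin y ^+ 2.
  by rewrite lerXn2r ?nnegrE // ?(le_trans _ ys) // mulr_ge0 // ltW.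
rewrite ler_pdivlMr ?exprn_gt0 // /y; set S := sin _; clearbody S.
by move: (k%:~R) => K; lra.
Qed.

End Trigonometry.

(** * Finite windows of integers *)

Section Windows.

(** The sum over [- L <= k < L]; [Negz i] is [- i - 1], so the window is
    invariant under [k -> - 1 - k] rather than under [k -> - k]. *)
Definition window_sum (V : nmodType) (L : nat) (u : int -> V) : V :=
  \sum_(0 <= i < L) (u (Posz i) + u (Negz i)).

Lemma window_sum_cat (V : nmodType) (K L : nat) (u : int -> V) : (K <= L)%N ->
  window_sum L u = window_sum K u + \sum_(K <= i < L) (u (Posz i) + u (Negz i)).
Proof. by move=> KL; rewrite /window_sum -big_cat_nat. Qed.

Lemma eq_window_sum (V : nmodType) (L : nat) (u v : int -> V) :
  u =1 v -> window_sum L u = window_sum L v.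
Proof. by move=> uv; apply: eq_bigr => i _; rewrite !uv. Qed.

(** Once the window is wide enough to see the index [0], summing [u (n - k)]
    over it runs through all indices below [n + L + 1]; this turns a window of a
    convolution into a partial sum of a power series. *)
Lemma window_sum_reflect (V : nmodType) (n : int) (L : nat) (u : int -> V) :
  (forall k, k < 0 -> u k = 0) -> (absz n < L)%N ->
  window_sum L (fun k => u (n - k)) =
  \sum_(0 <= j < absz (n + L%:Z + 1)) u (Posz j).
Proof.
move=> u0 nL; rewrite /window_sum big_split /=.
case: n nL => p pL.
  have -> : absz (Posz p + L%:Z + 1) = (L + p.+1)%N by lia.
  rewrite [in RHS](@big_cat_nat _ _ _ p.+1 0) /=; [|lia|lia]; congr (_ + _).
    rewrite (@big_cat_nat _ _ _ p.+1 0) /=; [|lia|lia].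
    rewrite [X in _ + X = _](_ : _ = 0) ?addr0; last first.
      by rewrite big_nat_cond big1 // => i pi; apply: u0; lia.
    rewrite [RHS]big_nat_rev; apply: eq_big_nat => i ip; congr u; lia.
  rewrite -[in RHS](add0n p.+1) big_addn add0n addnK.
  by apply: eq_bigr => i _; congr u; rewrite NegzE; lia.
have -> : absz (Negz p + L%:Z + 1) = (L - p)%N by rewrite NegzE; lia.
rewrite big1 ?add0r => [|i _]; last by apply: u0; rewrite NegzE; lia.
rewrite (@big_cat_nat _ _ _ p 0) /=; [|lia|move: pL; lia].
rewrite [X in X + _](_ : _ = 0) ?add0r; last first.
  by rewrite big_nat_cond big1 // => i pi; apply: u0; rewrite !NegzE; lia.
rewrite -[X in \sum_(X <= _ < _) _]add0n big_addn.
by apply: eq_bigr => i _; congr u; rewrite !NegzE; lia.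
Qed.

(** The three requirements on a truncation: it contains a given window, it
    satisfies the size condition of [window_sum_reflect], and the resulting
    partial sum is long. *)
Lemma exists_window (n : int) (K N : nat) :
  exists L, [/\ (K <= L)%N, (absz n < L)%N & (N <= absz (n + L%:Z + 1)%R)%N].
Proof. by exists (maxn K (N + (absz n).*2.+1)); split; lia. Qed.

Variable R : realType.

(** The weights are [O(1 / k ^ 2)] uniformly in [d], and [1 / k ^ 2] is
    dominated by the telescoping [1 / k - 1 / (k + 1)]. *)
Lemma riemann_weight_tail_le (d : R) (K L : nat) : (0 < K)%N -> (K <= L)%N ->
  \sum_(K <= i < L) (riemann_weight d (Posz i) + riemann_weight d (Negz i)) <=
  12 / K%:R.
Proof.
move=> K0 KL.
apply: (@le_trans _ _ (\sum_(K <= i < L) (- (12 / i.+1%:R) - - (12 / i%:R)))).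
  rewrite big_nat_cond [leRHS]big_nat_cond; apply: ler_sum => i; rewrite andbT.
  move=> /andP[Ki _]; have i0 : (0 < i)%N by lia.
  have := @riemann_weight_le _ d (Posz i) _.
  rewrite -lt0n => /(_ i0); have := @riemann_weight_le _ d (Negz i) isT.
  have -> : (Negz i)%:~R = - i.+1%:R :> R by rewrite NegzE mulrNz.
  rewrite sqrrN -[(Posz i)%:~R]/(i%:R : R) -[i.+1%:R]natr1.
  have x1 : 1 <= i%:R :> R by rewrite ler1n.
  move: (riemann_weight _ _) (riemann_weight _ _) x1.
  move: (i%:R : R) => x a b x1 ax bx.
  suff : 4 / x ^+ 2 + 4 / (x + 1) ^+ 2 <= - (12 / (x + 1)) - - (12 / x) by lra.
  rewrite -subr_ge0.
  have -> : - (12 / (x + 1)) - - (12 / x) - (4 / x ^+ 2 + 4 / (x + 1) ^+ 2) =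
    4 * (x ^+ 2 + x - 1) / (x ^+ 2 * (x + 1) ^+ 2).
    by field; apply/andP; split; lra.
  by apply: divr_ge0; nra.
rewrite telescope_sumr // opprK addrC lerBlDr lerDl divr_ge0 //.
Qed.

(** The frequencies [0 <= k < m] alone contribute at least
    [m * cos 1 ^+ 2 * d ^+ 2] with [d = 1 / m]; thus the mass is at least a fixed
    multiple of [d], the scale on which the integral bound also lives. *)
Lemma window_riemann_weight_ge (m K : nat) : (0 < m)%N -> (m <= K)%N ->
  cos 1 ^+ 2 * m%:R^-1 <= window_sum K (riemann_weight (m%:R^-1 : R)).
Proof.
move=> m0 mK; have M0 : 0 < m%:R :> R by rewrite ltr0n.
have w0 := @riemann_weight_ge0 R m%:R^-1.
rewrite (window_sum_cat _ mK) ler_wpDr ?sumr_ge0 // => [i _|].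
  by rewrite addr_ge0.
apply: (@le_trans _ _ (\sum_(0 <= i < m) cos 1 ^+ 2 * m%:R^-1 ^+ 2)).
  rewrite big_const_nat iter_addr_0 subn0 -mulr_natr.
  by rewrite le_eqVlt -mulrA; apply/orP; left; apply/eqP; field; lra.
rewrite big_nat_cond [leRHS]big_nat_cond; apply: ler_sum => i; rewrite andbT.
move=> /andP[_ im]; rewrite ler_wpDr //; apply: riemann_weight_ge => //.
by rewrite ler_pdivrMr // mul1r ler_nat ltnW.
Qed.

End Windows.

(** * Power series on the disc *)

Section Complex.
Variable R : realType.
Implicit Types (z w : R[i]) (s t r : R).
Local Notation Re := complex.Re.
Local Notation Im := complex.Im.

Lemma ReD z w : Re (z + w) = Re z + Re w.
Proof. by case: z w => ? ? [? ?]. Qed.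

Lemma ImD z w : Im (z + w) = Im z + Im w.
Proof. by case: z w => ? ? [? ?]. Qed.

Lemma Re_sum I (rs : seq I) (F : I -> R[i]) :
  Re (\sum_(i <- rs) F i) = \sum_(i <- rs) Re (F i).
Proof. exact: (big_morph (@complex.Re R) ReD erefl). Qed.

Lemma Im_sum I (rs : seq I) (F : I -> R[i]) :
  Im (\sum_(i <- rs) F i) = \sum_(i <- rs) Im (F i).
Proof. exact: (big_morph (@complex.Im R) ImD erefl). Qed.

Lemma Re_window_sum L (u : int -> R[i]) :
  Re (window_sum L u) = window_sum L (fun k => Re (u k)).
Proof. by rewrite /window_sum Re_sum; apply: eq_bigr => i _; rewrite ReD. Qed.

Lemma Re_realM (a : R) z : Re (a%:C%C * z) = a * Re z.
Proof. by case: z => b c /=; rewrite mul0r subr0. Qed.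

Lemma norm_Re_le z : `|Re z| <= normc z.
Proof.
case: z => a b /=; rewrite -sqrtr_sqr ler_wsqrtr // lerDl; exact: sqr_ge0.
Qed.

Lemma norm_Im_le z : `|Im z| <= normc z.
Proof.
case: z => a b /=; rewrite -sqrtr_sqr ler_wsqrtr // lerDr; exact: sqr_ge0.
Qed.

Lemma normc_real (a : R) : normc a%:C%C = `|a|.
Proof. by rewrite /= expr0n addr0 sqrtr_sqr. Qed.

Lemma normc_le_ReIm z : normc z <= `|Re z| + `|Im z|.
Proof.
have -> : z = (Re z)%:C%C + 'i%C * (Im z)%:C%C by exact: complexE.
apply: (le_trans (le_normcD _ _)); rewrite normcM !normc_real.
have -> : normc ('i%C : R[i]) = 1 by rewrite /= expr0n expr1n add0r sqrtr1.
by rewrite mul1r -complexE.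
Qed.

Lemma normc_sum_le I (rs : seq I) (F : I -> R[i]) :
  normc (\sum_(i <- rs) F i) <= \sum_(i <- rs) normc (F i).
Proof.
apply: (big_ind2 (fun (z : R[i]) (a : R) => normc z <= a)) => //.
  by rewrite normc0.
by move=> z a w b za wb; apply: (le_trans (le_normcD _ _)); exact: lerD.
Qed.

Lemma normcX z n : normc (z ^+ n) = normc z ^+ n.
Proof.
elim: n => [|n IH]; first by rewrite !expr0 normc1.
by rewrite !exprS normcM IH.
Qed.

Lemma expiD s t : expi (s + t) = expi s * expi t.
Proof.
rewrite /expi sinD cosD [RHS]/GRing.mul /=; congr (_ +i* _)%C.
by rewrite addrC.
Qed.

Lemma expi0 : expi (0 : R) = 1.
Proof. by rewrite /expi cos0 sin0. Qed.

Lemma normc_expi t : normc (expi t) = 1.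
Proof. by rewrite /expi /= cos2Dsin2 sqrtr1. Qed.

Lemma expi_natM n t : expi (n%:R * t) = expi t ^+ n.
Proof.
elim: n => [|n IH]; first by rewrite mul0r expi0 expr0.
by rewrite -natr1 mulrDl mul1r expiD IH exprSr.
Qed.

Lemma Re_mul_expi z (k : int) t :
  Re (z * expi (- (k%:~R * t))) = trigterm k (Re z) (Im z) t.
Proof. by case: z => a b /=; rewrite cosN sinN /trigterm mulrN opprK. Qed.

Lemma geometric_sum_le (r : R) (N m : nat) : 0 <= r < 1 -> (N <= m)%N ->
  \sum_(N <= i < m) r ^+ i <= r ^+ N / (1 - r).
Proof.
move=> /andP[r0 r1] Nm; have r10 : 0 < 1 - r by rewrite subr_gt0.
rewrite ler_pdivlMr // mulr_suml.
rewrite (eq_bigr (fun i => - r ^+ i.+1 - - r ^+ i)) => [|i _].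
  by rewrite telescope_sumr // opprK addrC lerBlDr lerDl exprn_ge0.
by rewrite exprS; ring.
Qed.

Lemma cvg_complex (u : nat -> R[i]^o) (a b : R) :
  (fun n => Re (u n)) @ \oo --> a -> (fun n => Im (u n)) @ \oo --> b ->
  u @ \oo --> ((a +i* b)%C : R[i]^o).
Proof.
move=> /cvgrPdist_lt ua /cvgrPdist_lt ub; apply/cvgrPdist_lt => e.
case: e => e e' /= ; rewrite ltcE /= => /andP[/eqP -> e0].
have e20 : 0 < e / 2 by rewrite divr_gt0.
near=> n; rewrite [X in X < _]normr_normc ltcR.
apply: (le_lt_trans (normc_le_ReIm _)).
rewrite [e]splitr; apply: ltrD.
  have : `|a - Re (u n)| < e / 2 by near: n; exact: ua.
  by case: (u n).
have : `|b - Im (u n)| < e / 2 by near: n; exact: ub.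
by case: (u n).
Unshelve. all: by end_near. Qed.

Lemma cvg_dominated_geometric (v : nat -> R) (M r : R) : 0 <= r < 1 -> 0 <= M ->
  (forall j, `|v j| <= M * r ^+ j) -> cvgn (series v).
Proof.
move=> /andP[r0 r1] M0 vle; apply: normed_cvg.
apply: (series_le_cvg (v_ := geometric M r)) => //.
- by move=> n; rewrite /= normr_ge0.
- by move=> n; rewrite /= mulr_ge0 ?exprn_ge0.
- by apply: is_cvg_geometric_series; rewrite ger0_norm.
Qed.

(** Uniform on circles [|z| = r < 1]; convergence of the complex series is
    obtained from its real and imaginary parts. *)
Lemma psihat_tail_le (psi : int -> R[i]) (M : R) z N :
  (forall n, normc (psi n) <= M) -> normc z < 1 ->
  normc (psihat psi z - \sum_(0 <= j < N) psi (Posz j) * z ^+ j) <=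
  M * (normc z ^+ N / (1 - normc z)).
Proof.
move=> psiM z1; have r01 : 0 <= normc z < 1 by rewrite normc_ge0.
have M0 : 0 <= M by apply: le_trans (psiM 0); exact: normc_ge0.
pose v j : R[i] := psi (Posz j) * z ^+ j.
have vle j : normc (v j) <= M * normc z ^+ j.
  by rewrite normcM normcX ler_wpM2r // exprn_ge0 // normc_ge0.
have cRe : cvgn (series (fun j => Re (v j))).
  apply: cvg_dominated_geometric r01 M0 _ => j.
  exact: le_trans (norm_Re_le _) (vle j).
have cIm : cvgn (series (fun j => Im (v j))).
  apply: cvg_dominated_geometric r01 M0 _ => j.
  exact: le_trans (norm_Im_le _) (vle j).
have cv : cvgn (series v : nat -> R[i]^o).
  apply/cvg_ex; exists ((limn (series (fun j => Re (v j))) +i*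
    limn (series (fun j => Im (v j))))%C : R[i]^o).
  apply: cvg_complex.
    by under eq_fun do rewrite /series /= Re_sum; exact: cRe.
  by under eq_fun do rewrite /series /= Im_sum; exact: cIm.
apply/ler_addgt0Pr => e e0.
have ec0 : (0 : R[i]) < e%:C%C by rewrite ltcR.
move/cvgrPdist_lt: cv => /(_ _ ec0)[N' _ /(_ (maxn N N') (leq_maxr _ _))] /=.
rewrite [X in X < _]normr_normc ltcR => lt_e.
set m := maxn N N' in lt_e.
have Nm : (N <= m)%N by exact: leq_maxl.
have -> : psihat psi z - \sum_(0 <= j < N) psi (Posz j) * z ^+ j =
    (psihat psi z - series v m) + \sum_(N <= j < m) v j.
  by rewrite /series /= (@big_cat_nat _ _ _ N 0 m) //= opprD addrA subrK.
apply: (le_trans (le_normcD _ _)); rewrite addrC; apply: lerD; last exact: ltW.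
apply: (le_trans (normc_sum_le _ _)).
apply: (@le_trans _ _ (\sum_(N <= j < m) M * normc z ^+ j)).
  by apply: ler_sum.
by rewrite -mulr_sumr ler_wpM2l // geometric_sum_le.
Qed.

(** Multiplying by [exp(i n t)] turns the frequencies [- k] into the indices
    [n - k], so the real trigonometric sum is dominated by a partial sum of the
    power series at [r exp(i t)].  The unimodular [w] makes the bound available
    for real and imaginary parts alike. *)
Lemma trigsum_window_le (psi : int -> R[i]) (n : int) (L : nat) (w : R[i])
    (r t : R) (a := fun k => w * (psi (n - k) * (r ^+ absz (n - k))%:C%C)) :
  (forall k, k < 0 -> psi k = 0) -> (absz n < L)%N -> normc w = 1 ->
  `|window_sum L (fun k => trigterm k (Re (a k)) (Im (a k)) t)| <=
  normc (\sum_(0 <= j < absz (n + L%:Z + 1)) psi (Posz j) * (r%:C%C * expi t) ^+ j).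
Proof.
move=> psi0 nL w1.
pose u (j : int) := psi j * (r ^+ absz j)%:C%C * expi (j%:~R * t).
have u0 k : k < 0 -> u k = 0 by move=> /psi0 pk; rewrite /u pk !mul0r.
have -> : \sum_(0 <= j < absz (n + L%:Z + 1)) psi (Posz j) * (r%:C%C * expi t) ^+ j =
    window_sum L (fun k => u (n - k)).
  rewrite (window_sum_reflect u0 nL); apply: eq_bigr => j _.
  by rewrite /u /= exprMn expi_natM rmorphXn mulrA.
have -> : window_sum L (fun k => trigterm k (Re (a k)) (Im (a k)) t) =
    Re (w * expi (- (n%:~R * t)) * window_sum L (fun k => u (n - k))).
  rewrite /window_sum mulr_sumr Re_sum; apply: eq_bigr => i _.
  have E k : trigterm k (Re (a k)) (Im (a k)) t =
      Re (w * expi (- (n%:~R * t)) * u (n - k)).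
    rewrite -Re_mul_expi; congr (Re _); rewrite /a /u.
    have -> : - (k%:~R * t) = - (n%:~R * t) + (n - k)%:~R * t.
      by rewrite intrB; ring.
    by rewrite expiD; ring.
  by rewrite !E -ReD mulrDr.
apply: (le_trans (norm_Re_le _)).
by rewrite normcM normcM w1 normc_expi !mul1r.
Qed.

End Complex.

(** * Integral bounds for trigonometric sums *)

Section Analysis.
Variable R : realType.
Local Notation mu := (@lebesgue_measure R).
Local Notation Re := complex.Re.
Local Notation Im := complex.Im.

Lemma cvg_window_sum (T : Type) (F : set_system T) (L : nat)
    (f : int -> T -> R) (l : int -> R) : Filter F ->
  (forall k, f k x @[x --> F] --> l k) ->
  window_sum L (fun k => f k x) @[x --> F] --> window_sum L l.
Proof.
move=> FF fl; apply: (cvg_big (op := +%R)) => [|i _].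
  exact: add_continuous.
by apply: cvgD.
Qed.

Lemma is_derive_window_sum (L : nat) (f df : int -> R -> R) :
  (forall k (u : R), is_derive u 1 (f k) (df k u)) ->
  forall u : R, is_derive u 1 (fun v => window_sum L (fun k => f k v))
    (window_sum L (fun k => df k u)).
Proof.
move=> fdf u; elim: L => [|L IH].
  rewrite [X in is_derive _ _ X](_ : _ = cst 0); last first.
    by apply/funext => v; rewrite /window_sum big_geq.
  by rewrite /window_sum big_geq //; exact: is_derive_cst.
rewrite [X in is_derive _ _ X](_ : _ = fun v =>
  window_sum L (fun k => f k v) + (f L v + f (Negz L) v)); last first.
  by apply/funext => v; rewrite /window_sum big_nat_recr.
rewrite /window_sum big_nat_recr //=.
by apply: is_deriveD => //; exact: is_deriveD.
Qed.

Lemma continuous_trigterm k (b c : R) : continuous (trigterm k b c).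
Proof.
move=> s; rewrite /trigterm; apply: cvgD; apply: cvgM; try exact: cvg_cst.
  by apply: continuous_comp; [apply: mulrl_continuous|apply: continuous_cos].
by apply: continuous_comp; [apply: mulrl_continuous|apply: continuous_sin].
Qed.

(** [second_difference_le] for the twice integrated trigonometric polynomial.
    Centring at [x] removes the sine contributions, whose second difference
    vanishes. *)
Lemma window_riemann_weight_le_integral (L : nat) (b c : int -> R)
    (h : R -> R) (x d : R) : 0 < d ->
  measurable_fun `[x - d, x + d] h ->
  (forall u, x - d <= u <= x + d ->
    `|window_sum L (fun k => trigterm k (b k) (c k) (u - x))| <= h u) ->
  (`|window_sum L (fun k => riemann_weight d k * b k)|%R%:E <=
   d%:E * \int[mu]_(u in `[(x - d)%R, (x + d)%R]) (h u)%:E)%E.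
Proof.
move=> d0 mh hle.
have d2 := is_derive_window_sum L (fun k => is_derive_comp_subr x
  (is_derive_trigterm_prim2 k (b k) (c k))).
have d1 := is_derive_window_sum L (fun k => is_derive_comp_subr x
  (is_derive_trigterm_prim k (b k) (c k))).
apply: le_trans (second_difference_le d0 d2 d1 _ mh hle).
  rewrite (_ : window_sum L (fun k => riemann_weight d k * b k) =
    window_sum L (fun k =>
    trigterm_prim2 k (b k) (c k) (x + d - x)) + window_sum L (fun k =>
    trigterm_prim2 k (b k) (c k) (x - d - x)) - window_sum L (fun k =>
    trigterm_prim2 k (b k) (c k) (x - x)) *+ 2) //.
  rewrite /window_sum -sumrMnl -big_split -sumrB; apply: eq_bigr => i _ /=.
  rewrite -(trigterm_second_difference i _ (c i)).
  rewrite -(trigterm_second_difference (Negz i) _ (c (Negz i))).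
  have -> : x + d - x = d by ring.
  have -> : x - d - x = - d by ring.
  rewrite subrr; ring.
move=> u; apply: cvg_window_sum => k.
apply: (@continuous_comp _ _ _ (fun v => v - x) (trigterm k (b k) (c k))).
  by apply: cvgB; [exact: cvg_id|exact: cvg_cst].
exact: continuous_trigterm.
Qed.

Lemma measurable_normc (D : set R) (g : R -> R[i]) :
  measurable_fun D (fun t => Re (g t)) -> measurable_fun D (fun t => Im (g t)) ->
  measurable_fun D (fun t => normc (g t)).
Proof.
move=> mRe mIm.
rewrite (_ : (fun t => normc (g t)) =
  (fun t => Num.sqrt (Re (g t) ^+ 2 + Im (g t) ^+ 2))); last first.
  by apply/funext => t; case: (g t).
have msqrt : measurable_fun setT (@Num.sqrt R).
  by apply: continuous_measurable_fun; exact: sqrt_continuous.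
apply: (measurableT_comp msqrt).
by apply: measurable_funD; apply: measurable_funX.
Qed.

Lemma complex_L1_measurable (D : set R) (g : R -> R[i]) : complex_L1 D g ->
  measurable_fun D (fun t => Re (g t)) /\ measurable_fun D (fun t => Im (g t)).
Proof.
by move=> [/measurable_int/measurable_EFinP ? /measurable_int/measurable_EFinP ?].
Qed.

Lemma complex_L1_normc (i : interval R) (g : R -> R[i]) :
  complex_L1 [set` i] g -> mu.-integrable [set` i] (fun t => (normc (g t))%:E).
Proof.
move=> gL1; have [mRe mIm] := complex_L1_measurable gL1.
case: gL1 => /integrable_norm iRe /integrable_norm iIm.
have := @integrableD _ _ _ mu _ _ _ _ iRe iIm; move/(_ (measurable_itv i)).
apply: le_integrable => //.
  by apply/measurable_EFinP; exact: measurable_normc.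
move=> t _ /=; rewrite lee_fin ger0_norm ?normc_ge0 //.
exact: (le_trans (normc_le_ReIm _) (ler_norm _)).
Qed.

(** Absolute continuity of the integral, on shrinking intervals around [x]. *)
Lemma integral_itv_small (g : R -> R) (x delta : R) : 0 < delta ->
  mu.-integrable `]x - delta, x + delta[ (fun t => (g t)%:E) ->
  (forall t, 0 <= g t) ->
  forall e : R, 0 < e -> exists2 d0 : R, 0 < d0 & forall d, 0 < d < d0 ->
    d < delta /\ (\int[mu]_(t in `[(x - d)%R, (x + d)%R]) (g t)%:E <= e%:E)%E.
Proof.
move=> delta0 ig g0 e e0.
set I := [set` _] in ig.
have ig' : mu.-integrable setT (EFin \o (g \_ I)).
  have -> : EFin \o (g \_ I) = (fun t => (g t)%:E) \_ I.
    by apply/funext => t; rewrite /= !patchE; case: ifP.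
  by apply: (iffLR (@integrable_mkcond _ _ _ mu _ (fun t => (g t)%:E)
    (measurable_itv _))).
have [d1 [d10 Hd1]] := integral_normr_continuous ig' e0.
exists (Num.min delta (d1 / 2)) => [|d /andP[d0]].
  by rewrite lt_min delta0 divr_gt0.
rewrite lt_min => /andP[ddelta dd1]; split => //.
set J := [set` _].
have JI : J `<=` I.
  by move=> t; rewrite /J /I /= !in_itv /=; lra.
have muJ : (mu J < d1%:E)%E.
  rewrite /J lebesgue_measure_itv /= lte_fin ifT; last by lra.
  by rewrite lte_fin; lra.
have := Hd1 J (measurable_itv _) muJ.
have iJ : mu.-integrable J (fun t => (g t)%:E) by apply: integrableS ig => //; exact: measurable_itv.
have -> : (\int[mu]_(t in J) `|(g \_ I) t|)%R = fine (\int[mu]_(t in J) (g t)%:E).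
  rewrite /Rintegral; congr fine; apply: eq_integral => t /set_mem /JI tI.
  by rewrite patchE mem_set // ger0_norm.
rewrite -lte_fin fineK => [/ltW //|].
by apply: integrable_fin_num iJ; exact: measurable_itv.
Qed.

End Analysis.

(** * Convolution windows near the boundary *)

Section Estimate.
Variable R : realType.
Local Notation mu := (@lebesgue_measure R).
Local Notation Re := complex.Re.
Local Notation Im := complex.Im.
Variables (psi : int -> R[i]) (M : R).
Hypothesis psi_neg : forall k, k < 0 -> psi k = 0.
Hypothesis psi_le : forall k, normc (psi k) <= M.
Variables (t0 delta : R) (F : R[i] -> R[i]).
Hypothesis expi_t0 : expi t0 = 1.
Let I := `]t0 - delta, t0 + delta[%classic.
Hypothesis F_L1 : complex_L1 I (fun t => F (expi t)).
Variables (d f : R).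
Hypothesis d_gt0 : 0 < d.
Hypothesis d_delta : d < delta.
Let J := `[t0 - d, t0 + d]%classic.
Hypothesis f_ge : (\int[mu]_(t in J) (normc (F (expi t)))%:E <= f%:E)%E.

Let M_ge0 : 0 <= M.
Proof. by apply: le_trans (psi_le 0); exact: normc_ge0. Qed.

Let JI : J `<=` I.
Proof. by move=> t; rewrite /J /I /= !in_itv /=; have := d_delta; lra. Qed.

Lemma expi_subt0 t : expi (t - t0) = expi t.
Proof. by have := expiD (t - t0) t0; rewrite subrK expi_t0 mulr1. Qed.

Lemma expr_small (r e : R) : 0 <= r < 1 -> 0 < e ->
  exists N0, forall N, (N0 <= N)%N -> r ^+ N < e.
Proof.
move=> /andP[r0 r1] e0; have r1' : `|r| < 1 by rewrite ger0_norm.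
have := @cvg_geometric R 1 r r1'.
move=> /cvgrPdist_lt /(_ _ e0)[N0 _ HN]; exists N0 => N /HN.
by rewrite /= mul1r sub0r normrN ger0_norm // exprn_ge0.
Qed.

Section Radius.
Variables (r : R).
Hypothesis r01 : 0 <= r < 1.
Let g t := psihat psi (r%:C%C * expi t).
Hypothesis g_L1 : complex_L1 I g.
Variable (E : R).
Hypothesis E_ge : (\int[mu]_(t in I) (normc (g t - F (expi t)))%:E <= E%:E)%E.

Lemma measurable_gap : measurable_fun I (fun t => normc (g t - F (expi t))).
Proof.
have [mF mF'] := complex_L1_measurable F_L1.
have [mg mg'] := complex_L1_measurable g_L1.
apply: measurable_normc.
  rewrite (_ : (fun t => _) = (fun t => Re (g t) - Re (F (expi t)))).
    exact: measurable_funB.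
  by apply/funext => t; case: (g t) (F (expi t)) => ? ? [].
rewrite (_ : (fun t => _) = (fun t => Im (g t) - Im (F (expi t)))).
  exact: measurable_funB.
by apply/funext => t; case: (g t) (F (expi t)) => ? ? [].
Qed.

Lemma integral_majorant_le (c : R) : 0 <= c ->
  (\int[mu]_(t in J)
     (normc (g t - F (expi t)) + normc (F (expi t)) + c)%:E <=
   (E + f + c * (d *+ 2))%:E)%E.
Proof.
move=> c0.
have mJI (h : R -> R) : measurable_fun I h -> measurable_fun J h.
  by apply: measurable_funS => //; exact: measurable_itv.
have mgap := mJI _ measurable_gap.
have mF : measurable_fun J (fun t => normc (F (expi t))).
  by apply: mJI; apply: measurable_normc; case: (complex_L1_measurable F_L1).
have mc : measurable_fun J (fun _ : R => c) by [].
under eq_integral do rewrite EFinD EFinD.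
rewrite ge0_integralD //=; last 3 first.
- exact: measurable_itv.
- by move=> t _; rewrite -EFinD lee_fin addr_ge0 ?normc_ge0.
- by apply/measurable_EFinP; apply: measurable_funD.
rewrite ge0_integralD //=; last 5 first.
- exact: measurable_itv.
- by move=> t _; rewrite lee_fin normc_ge0.
- exact/measurable_EFinP.
- by move=> t _; rewrite lee_fin normc_ge0.
- exact/measurable_EFinP.
rewrite !EFinD; apply: leeD; first apply: leeD => //.
  apply: le_trans E_ge; apply: ge0_subset_integral => //.
  - exact: measurable_itv.
  - exact: measurable_itv.
  - by apply/measurable_EFinP; exact: measurable_gap.
  - by move=> t _; rewrite lee_fin normc_ge0.
have muJ : mu J = (d *+ 2)%:E.
  rewrite /J lebesgue_measure_itv /= lte_fin ifT; last by have := d_gt0; lra.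
  by rewrite -EFinB; congr EFin; ring.
rewrite (_ : (\int[mu]_(_ in J) c%:E)%E = (c%:E * mu J)%E).
  by rewrite muJ.
by apply: integral_cst; exact: measurable_itv.
Qed.

Variables (w : R[i]) (n : int) (K : nat).
Hypothesis w1 : normc w = 1.
Hypothesis K_gt0 : (0 < K)%N.

(** On the circle of radius [r] the window [K] is enlarged to a window [L] whose
    trigonometric sum is, up to the geometric remainder [cN], bounded by
    [|psihat - F| + |F|] on [J].  The added terms cost the tail of the weights,
    uniformly in [n], and letting [L] grow removes [cN]. *)
Lemma radial_window_le :
  `|window_sum K (fun k => riemann_weight d k *
      Re (w * (psi (n - k) * (r ^+ absz (n - k))%:C%C)))| <=
  d * (E + f) + M * (12 / K%:R).
Proof.
have /andP[r0 r1] := r01.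
have r10 : 0 < 1 - r by rewrite subr_gt0.
pose a k := w * (psi (n - k) * (r ^+ absz (n - k))%:C%C).
have a_le k : `|Re (a k)| <= M.
  apply: (le_trans (norm_Re_le _)); rewrite /a normcM w1 mul1r normcM normc_real.
  rewrite -[leRHS]mulr1 ler_pM ?normc_ge0 // ger0_norm ?exprn_ge0 //.
  by rewrite exprn_ile1 // ltW.
apply/ler_addgt0Pr => e e0.
(* [c * r ^+ N] is what the remainder [cN] contributes to the final bound *)
pose c := M / (1 - r) * (d *+ 2) * d.
have c0 : 0 <= c by rewrite /c !mulr_ge0 ?mulrn_wge0 ?invr_ge0 // ltW.
have [N0 HN0] := @expr_small r (e / (c + 1)) r01 (divr_gt0 e0 (ltr_wpDl c0 ltr01)).
have [L [KL nL NN0]] := exists_window n K N0.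
set N := absz (n + L%:Z + 1) in NN0.
pose cN := M * (r ^+ N / (1 - r)).
have cN0 : 0 <= cN by rewrite /cN mulr_ge0 // divr_ge0 ?exprn_ge0 // ltW.
pose h t := normc (g t - F (expi t)) + normc (F (expi t)) + cN.
have mh : measurable_fun J h.
  apply: measurable_funD => //; apply: measurable_funD.
    by apply: measurable_funS measurable_gap => //; exact: measurable_itv.
  apply: (@measurable_funS _ _ _ _ I) => //; first exact: measurable_itv.
  by apply: measurable_normc; case: (complex_L1_measurable F_L1).
have window_le : `|window_sum L (fun k => riemann_weight d k * Re (a k))| <=
    d * (E + f + cN * (d *+ 2)).
  rewrite -lee_fin; apply: (le_trans
    (@window_riemann_weight_le_integral R L _ (fun k => Im (a k)) h t0 d _ _ _)) => //.
    move=> t _.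
    apply: (le_trans (trigsum_window_le r (t - t0) psi_neg nL w1)).
    rewrite expi_subt0 -/N /h.
    set S := \sum_(0 <= j < N) _.
    rewrite -[S](addrNK (g t)) -[S - g t]opprB.
    have -> : - (g t - S) + g t =
      - (g t - S) + (g t - F (expi t)) + F (expi t) by ring.
    apply: (le_trans (le_normcD _ _)); rewrite [leRHS]addrAC lerD2r.
    apply: (le_trans (le_normcD _ _)); rewrite [leRHS]addrC lerD2r normcN.
    have nz : normc (r%:C%C * expi t) = r.
      by rewrite normcM normc_real normc_expi mulr1 ger0_norm.
    have := @psihat_tail_le R psi M (r%:C%C * expi t) N psi_le.
    by rewrite nz; apply.
  by rewrite EFinM lee_pmul2l //; exact: integral_majorant_le.
have -> : window_sum K (fun k => riemann_weight d k * Re (a k)) =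
    window_sum L (fun k => riemann_weight d k * Re (a k)) -
    \sum_(K <= i < L) (riemann_weight d i * Re (a i) +
      riemann_weight d (Negz i) * Re (a (Negz i))).
  by rewrite (window_sum_cat _ KL) addrK.
apply: (le_trans (ler_normB _ _)).
have tail_le : `|\sum_(K <= i < L) (riemann_weight d i * Re (a i) +
    riemann_weight d (Negz i) * Re (a (Negz i)))| <= M * (12 / K%:R).
  apply: (le_trans (ler_norm_sum _ _ _)).
  apply: (@le_trans _ _ (M * \sum_(K <= i < L)
     (riemann_weight d i + riemann_weight d (Negz i)))).
    rewrite mulr_sumr; apply: ler_sum => i _.
    apply: (le_trans (ler_normD _ _)); rewrite mulrDr.
    by apply: lerD; rewrite normrM ger0_norm ?riemann_weight_ge0 // mulrC
      ler_wpM2r ?riemann_weight_ge0.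
  by rewrite ler_wpM2l // riemann_weight_tail_le.
have cNe : d * (cN * (d *+ 2)) <= e.
  have := HN0 N NN0; rewrite ltr_pdivlMr ?ltr_wpDl // => He.
  have -> : d * (cN * (d *+ 2)) = r ^+ N * c by rewrite /cN /c; ring.
  by apply: ltW; apply: le_lt_trans He; rewrite ler_wpM2l ?exprn_ge0 // lerDl.
move: window_le tail_le; rewrite mulrDr.
by lra.
Qed.

End Radius.

Hypothesis psihat_L1 :
  \forall r \near 1^'-, complex_L1 I (fun t => psihat psi (r%:C%C * expi t)).
Hypothesis psihat_cvg :
  (\int[mu]_(t in I)
     (normc (psihat psi (r%:C%C * expi t) - F (expi t)))%:E)%E
    @[r --> (1 : R)^'-] --> 0%E.

(** Let [r] tend to [1] in [radial_window_le]: the window is a fixed finite sum,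
    hence continuous in [r], and the gap [E] tends to [0] by the boundary
    behaviour. *)
Lemma window_Re_le (w : R[i]) (n : int) (K : nat) : normc w = 1 -> (0 < K)%N ->
  `|window_sum K (fun k => riemann_weight d k * Re (w * psi (n - k)))| <=
  d * f + M * (12 / K%:R).
Proof.
move=> w1 K0.
pose S (r : R) := window_sum K (fun k => riemann_weight d k *
  Re (w * (psi (n - k) * (r ^+ absz (n - k))%:C%C))).
have S1 : S r @[r --> (1 : R)^'-] -->
    window_sum K (fun k => riemann_weight d k * Re (w * psi (n - k))).
  apply: cvg_at_left_filter; apply: cvg_window_sum => k.
  under eq_fun do rewrite mulrA [_ * _%:C%C]mulrC Re_realM.
  apply: cvgM; first exact: cvg_cst.
  rewrite -[X in _ --> X]mul1r; apply: cvgM; last exact: cvg_cst.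
  rewrite -[X in _ --> X](expr1n _ (absz (n - k))).
  exact: exprn_continuous.
apply/ler_addgt0Pr => e e0.
have e1 : 0 < e / (d + 1) by rewrite divr_gt0 // addr_gt0.
have /fine_cvgP[Efin /cvgrPdist_lt Ecvg] := psihat_cvg.
have XE : `|window_sum K (fun k => riemann_weight d k * Re (w * psi (n - k)))|
    <= d * (e / (d + 1) + f) + M * (12 / K%:R) + e / (d + 1).
  near (1 : R)^'- => r.
  have r01 : 0 <= r < 1.
    apply/andP; split; last by near: r; exact: nbhs_left_lt.
    by near: r; apply: nbhs_left_ge; exact: ltr01.
  have gr : complex_L1 I (fun t => psihat psi (r%:C%C * expi t)) by near: r.
  have Er : (\int[mu]_(t in I)
      (normc (psihat psi (r%:C%C * expi t) - F (expi t)))%:E <=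
      (e / (d + 1))%:E)%E.
    rewrite -[leLHS]fineK; last by near: r.
    rewrite lee_fin; apply: ltW; apply: le_lt_trans (ler_norm _) _.
    rewrite -normrN -sub0r; near: r; exact: Ecvg.
  have Sr : `|window_sum K (fun k => riemann_weight d k * Re (w * psi (n - k))) -
      S r| <= e / (d + 1).
    near: r; move/cvgrPdist_le: S1; exact.
  rewrite -[X in `|X|](subrK (S r)) addrC; apply: (le_trans (ler_normD _ _)).
  exact: lerD (radial_window_le r01 gr Er n w1 K0) Sr.
apply: (le_trans XE).
have -> : d * (e / (d + 1) + f) + M * (12 / K%:R) + e / (d + 1) =
  d * f + M * (12 / K%:R) + e.
  have d1 : d + 1 != 0 by apply: lt0r_neq0; rewrite addr_gt0.
  by field; rewrite d1 pnatr_eq0 -lt0n K0.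
by [].
Unshelve. all: by end_near. Qed.

Lemma window_normc_le (n : int) (K : nat) : (0 < K)%N ->
  normc (window_sum K (fun k => (riemann_weight d k)%:C%C * psi (n - k))) <=
  (d * f + M * (12 / K%:R)) *+ 2.
Proof.
move=> K0; apply: (le_trans (normc_le_ReIm _)); rewrite mulr2n; apply: lerD.
  have := @window_Re_le 1 n K (normc1 _) K0.
  rewrite Re_window_sum.
  by under eq_window_sum do rewrite mul1r -Re_realM.
have w1 : normc (- 'i%C : R[i]) = 1.
  by rewrite normcN /= expr0n expr1n add0r sqrtr1.
have := @window_Re_le _ n K w1 K0.
have -> z : Im z = Re (- 'i%C * z) by case: z => a b /=; ring.
rewrite /window_sum mulr_sumr Re_sum.
congr (`|_| <= _); apply: eq_bigr => i _.
by rewrite mulrDr ReD -!Re_realM; congr (Re _ + Re _); ring.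
Qed.

End Estimate.

(** * Averaging kernels and means *)

Section Kernel.
Variable R : realType.
Local Notation mu := (@lebesgue_measure R).

Definition in_window (K : nat) (k : int) : bool :=
  match k with Posz i | Negz i => (i < K)%N end.

Lemma zsum_window (K : nat) (u : int -> R[i]) :
  (forall k, ~~ in_window K k -> u k = 0) -> zsum u = window_sum K u.
Proof.
move=> u0; rewrite /window_sum big_split /= /zsum.
have lim_series (v : nat -> R[i]) : (forall i, (K <= i)%N -> v i = 0) ->
    limn (series v : nat -> R[i]^o) = \sum_(0 <= i < K) v i.
  move=> v0; apply: lim_near_cst; first exact: norm_hausdorff.
  exists K => // N /= KN; rewrite /series /= (@big_cat_nat _ _ _ K 0 N) //=.
  rewrite [X in _ + X](_ : _ = 0) ?addr0 //.
  by rewrite big_nat_cond big1 // => i /andP[/andP[Ki _] _]; apply: v0.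
by congr (_ + _); apply: lim_series => i Ki; apply: u0; rewrite /= -leqNgt.
Qed.

Lemma l1_window (K : nat) (f : int -> R[i]) :
  (forall k, ~~ in_window K k -> f k = 0) -> l1 f.
Proof.
move=> f0; rewrite /l1; pose W := [set k | in_window K k].
have -> : (\esum_(k in [set: int]) (normc (f k))%:E =
    \esum_(k in W) (normc (f k))%:E)%E.
  rewrite [RHS]esum_mkcond; apply: eq_esum => k _; case: ifPn => // /negP kW.
  by rewrite f0 ?normc0 //; apply/negP => kK; apply: kW; rewrite inE.
have finW : finite_set W.
  apply: (@sub_finite_set _ _
    [set` [seq Posz i | i <- iota 0 K] ++ [seq Negz i | i <- iota 0 K]]).
    move=> k /=; rewrite mem_cat; case: k => i iK; apply/orP; [left|right];
      by apply/mapP; exists i; rewrite // mem_iota.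
  exact: finite_seq.
rewrite esum_fset => [||k _]; last by rewrite lee_fin normc_ge0.
  by rewrite fsbig_finite //= sumEFin ltry.
by [].
Qed.

(** Truncating and normalising the Riemann weights gives a probability [f] of
    finite support.  Its mass is at least [c * d] while the unnormalised
    convolution is at most [2 (d * e * c / 4 + 12 M / K)]: first [d] is chosen so
    that the boundary function has small integral, then [K]. *)
Lemma exists_averaging_kernel (psi : int -> R[i]) (M : R) :
  (forall k, k < 0 -> psi k = 0) -> (forall k, normc (psi k) <= M) ->
  H1_boundary_behavior (psihat psi) 1 ->
  forall e : R, 0 < e -> exists f : int -> R[i],
    [/\ l1 f, forall k, 0 <= f k, zsum f = 1 &
        forall n, normc (Defs.conv f psi n) <= e].
Proof.
move=> psi_neg psi_le [t0 [delta [F [t0E delta0 FL1 psiL1 psicvg]]]] e e0.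
have M0 : 0 <= M by apply: le_trans (psi_le 0); exact: normc_ge0.
pose c : R := cos 1 ^+ 2.
have c0 : 0 < c by rewrite exprn_gt0 // cos1_gt0.
have ec0 : 0 < e * c / 4 by rewrite divr_gt0 // mulr_gt0.
have [d0 d00 Hd0] := @integral_itv_small R (fun t => normc (F (expi t))) t0
  delta delta0 (complex_L1_normc FL1) (fun t => normc_ge0 _) _ ec0.
pose m := (Num.truncn d0^-1).+1.
have m0 : 0 < (m%:R : R) by rewrite ltr0n.
pose d : R := m%:R^-1.
have dgt0 : 0 < d by rewrite invr_gt0.
have dd0 : d < d0.
  rewrite /d -[ltRHS]invrK ltf_pV2 ?posrE ?invr_gt0 //.
  exact: truncnS_gt.
have [ddelta Fsmall] := Hd0 d (introT andP (conj dgt0 dd0)).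
pose K := maxn m (Num.truncn (48 * M / (c * d * e))).+1.
have mK : (m <= K)%N by exact: leq_maxl.
have K0 : (0 < K)%N by exact: leq_trans mK.
have KR : 48 * M / (c * d * e) <= K%:R.
  apply: ltW; apply: (lt_le_trans (truncnS_gt _)).
  by rewrite ler_nat leq_maxr.
pose S := window_sum K (riemann_weight d).
have S_ge : c * d <= S by exact: window_riemann_weight_ge.
have S0 : 0 < S by apply: lt_le_trans S_ge; rewrite mulr_gt0.
pose f k : R[i] := if in_window K k then (riemann_weight d k / S)%:C%C else 0.
have f0 k : ~~ in_window K k -> f k = 0 by rewrite /f => /negbTE ->.
have fE (u : int -> R[i]) : window_sum K (fun k => f k * u k) =
    (S^-1)%:C%C * window_sum K (fun k => (riemann_weight d k)%:C%C * u k).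
  rewrite /window_sum mulr_sumr big_nat_cond [RHS]big_nat_cond.
  apply: eq_bigr => i /andP[/andP[_ iK] _].
  by rewrite /f /= iK mulrDr !mulrA -!rmorphM /= ![S^-1 * _]mulrC.
exists f; split.
- exact: l1_window f0.
- move=> k; rewrite /f; case: ifP => // _.
  by rewrite lecR divr_ge0 ?riemann_weight_ge0 // ltW.
- rewrite (zsum_window f0).
  have -> : window_sum K f = window_sum K (fun k => f k * 1).
    by apply: eq_window_sum => k; rewrite mulr1.
  rewrite fE.
  have -> : window_sum K (fun k => (riemann_weight d k)%:C%C * 1) = S%:C%C.
    rewrite /S /window_sum rmorph_sum; apply: eq_bigr => i _.
    by rewrite !mulr1 rmorphD.
  by rewrite -rmorphM mulVf ?gt_eqF.
move=> n; rewrite /Defs.conv (@zsum_window K) => [|k kK]; last by rewrite f0 ?mul0r.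
rewrite fE normcM normc_real gtr0_norm ?invr_gt0 // mulrC ler_pdivrMr //.
have := window_normc_le psi_neg psi_le (esym t0E) FL1 dgt0 ddelta Fsmall
  psiL1 psicvg n K0.
move/le_trans; apply; apply: le_trans (ler_wpM2l (ltW e0) S_ge).
have KR0 : 0 < K%:R :> R by rewrite ltr0n.
have : M * (12 / K%:R) <= c * d * e / 4.
  rewrite mulrA ler_pdivrMr //; move: KR.
  rewrite ler_pdivrMr; last exact: mulr_gt0 (mulr_gt0 c0 dgt0) e0.
  by move: (c * d * e) (K%:R : R) => p k; lra.
move: (M * (12 / K%:R)) => x; move: (d) => y; lra.
Qed.

Lemma linfty_norm_le (psi : linfty R) (e : R) :
  (forall n, normc (psi n) <= e) -> linfty_norm psi <= e.
Proof.
move=> psie; apply: ge_sup; first by exists (normc (psi 0)), 0.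
by move=> _ [n _ <-].
Qed.

Lemma linfty_norm_ge0 (psi : linfty R) : 0 <= linfty_norm psi.
Proof.
have /linfty_predP[M psiM] := valP psi.
apply: (le_trans (normc_ge0 (psi 0))); apply: ub_le_sup; last by exists 0.
by exists M => _ [n _ <-]; exact: psiM.
Qed.

End Kernel.

Theorem theorem8p1 (R : realType) (psi : linfty R)
  (psi_neg : forall n : int, n < 0 -> psi n = 0)
  (psi_H1 : H1_boundary_behavior (psihat psi) 1) :
  almost_convergent psi 0.
Proof.
move=> phi [[B phiB] _ _] phi_inv.
have /linfty_predP[M psi_le] := valP psi.
apply: eq0_normc; apply/eqP; rewrite eq_le normc_ge0 andbT.
apply/ler_addgt0Pr => e e0; rewrite add0r.
have B0 : 0 < `|B| + 1 by rewrite ltr_wpDl.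
have [f [fl1 f0 f1 fe]] :=
  exists_averaging_kernel psi_neg psi_le psi_H1 (divr_gt0 e0 B0).
rewrite -(phi_inv f fl1 psi f0 f1).
apply: (le_trans (phiB _)).
have norm_le : linfty_norm (linfty_conv fl1 psi) <= e / (`|B| + 1).
  exact: linfty_norm_le.
apply: (@le_trans _ _ ((`|B| + 1) * (e / (`|B| + 1)))).
  apply: le_trans (ler_wpM2l (ltW B0) norm_le).
  rewrite ler_wpM2r ?linfty_norm_ge0 //.
  by apply: (le_trans (ler_norm B)); rewrite lerDl.
by rewrite mulrC divfK // gt_eqF.
Qed.
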